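(* Let $f:[0,\infty)\to\mathbb{R}_+$ be the unique continuous extension to $[0,\infty)$ of the function $x\mapsto \frac{(1-x)+x\ln(x)}{(x-1)^2}$ defined on $[0,\infty)\setminus\{0,1\}$ (so $f(0)=1$, $f(1)=\tfrac12$). For every finite triangle-free graph $G$ and every strictly positive weight function $w:V(G)\to\mathbb{R}_+$ there exists a probability distribution $\mathcal{D}$ on the independent sets of $G$ such that $$\mathbb{P}_{I\sim\mathcal{D}}[v\in I]\ge f\left(\frac{w(N_G(v))}{w(v)}\right)$$ for every vertex $v\in V(G)$.
   Context: For $X\subseteq V(G)$, $w(X):=\sum_{v\in X}w(v)$. $N_G(v)$ denotes the (open) neighborhood of $v$ in $G$. A graph is triangle-free if it contains no three pairwise adjacent vertices. *)

(* Defs.v *)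
From HB Require Import structures.
From mathcomp Require Import all_boot all_order all_algebra.
From mathcomp Require Import all_classical all_reals all_analysis.
From mathcomp Require Import ring lra.

Set Implicit Arguments.
Unset Strict Implicit.
Unset Printing Implicit Defensive.

Import Order.TTheory GRing.Theory Num.Theory.
Import numFieldNormedType.Exports.

Local Open Scope classical_set_scope.
Local Open Scope ring_scope.

Section ContinuousExtension.
Context {R : realType}.

Definition fexpr (x : R) : R := ((1 - x) + x * ln x) / (x - 1) ^+ 2.

(* f : [0, oo) -> R is a total function on R; its values on negative reals
   are irrelevant.  [fext_exists] and [fext_unique] below show that exactly one
   function on [0, oo) satisfies this, and that it is nonnegative. *)
Definition is_fext (f : R -> R) : Prop :=
  {within `[0, +oo[%classic, continuous f} /\
  (forall x : R, 0 <= x -> x != 0 -> x != 1 -> f x = fexpr x).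

End ContinuousExtension.

Section Graphs.
Variable T : finType.

Definition triangle_free (e : rel T) : Prop :=
  ~ exists x y z : T, [/\ e x y, e y z & e x z].

Definition neighborhood (e : rel T) (v : T) : {set T} := [set u | e v u]%SET.

Definition independent (e : rel T) (I : {set T}) : Prop :=
  forall x y : T, x \in I -> y \in I -> ~~ e x y.

Definition weight (R : realType) (w : T -> R) (X : {set T}) : R :=
  \sum_(v in X) w v.

Definition indep_distribution (R : realType) (e : rel T)
    (D : {ffun {set T} -> R}) : Prop :=
  [/\ forall I : {set T}, 0 <= D I,
      \sum_(I : {set T}) D I = 1 &
      forall I : {set T}, D I != 0 -> independent e I].

Definition prob (R : realType) (D : {ffun {set T} -> R})
    (E : pred {set T}) : R := \sum_(I : {set T} | E I) D I.

End Graphs.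

Section WellDefinedness.
Context {R : realType}.
Implicit Types (f g : R -> R) (x : R).

Lemma within_cvg_at_right f x : 0 <= x ->
  {within `[0, +oo[%classic, continuous f} -> f y @[y --> x^'+] --> f x.
Proof.
move=> x0 /continuous_within_itvcyP[cf f0].
have [->//|xn0] := eqVneq x 0.
apply: cvg_at_right_filter; apply: cf.
by rewrite in_itv/= andbT lt_neqAle eq_sym xn0.
Qed.

Lemma fext_unique f g : is_fext f -> is_fext g ->
  {in `[0, +oo[, f =1 g}.
Proof.
move=> [cf fE] [cg gE] x; rewrite in_itv/= andbT => x0.
have fx := within_cvg_at_right x0 cf.
have gx := within_cvg_at_right x0 cg.
suff fg : f y @[y --> x^'+] --> g x by exact: cvg_unique fx fg.
apply: cvg_trans gx; apply: near_eq_cvg.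
have [x1|x1] := ltP x 1.
  near=> y.
  have xy : x < y by near: y; exact: nbhs_right_gt.
  have y1 : y < 1 by near: y; exact: nbhs_right_lt.
  have y0 := le_lt_trans x0 xy.
  by rewrite fE ?gE ?(ltW y0) ?(gt_eqF y0) ?(lt_eqF y1).
near=> y.
have xy : x < y by near: y; exact: nbhs_right_gt.
have y0 := le_lt_trans x0 xy.
have y1 := le_lt_trans x1 xy.
by rewrite fE ?gE ?(ltW y0) ?(gt_eqF y0) ?(gt_eqF y1).
Unshelve. all: by end_near. Qed.

Lemma xlnx_cvg0 : x * ln x @[x --> (0:R)^'+] --> (0:R).
Proof.
have sq : Num.sqrt x @[x --> (0:R)^'+] --> (0:R).
  apply: cvg_at_right_filter; rewrite -[X in _ --> X]sqrtr0.
  exact: sqrt_continuous.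
apply: (@squeeze_cvgr _ _ _ _ (fun x => - 2 * Num.sqrt x) (fun=> 0)).
- near=> x.
  have x0 : 0 < x by near: x; exact: nbhs_right_gt.
  have x1 : x < 1 by near: x; exact: nbhs_right_lt.
  have y0 : 0 < Num.sqrt x by rewrite sqrtr_gt0.
  have xE : x = Num.sqrt x ^+ 2 by rewrite sqr_sqrtr// ltW.
  apply/andP; split; last first.
    by rewrite mulr_ge0_le0 ?(ltW x0)// ln_le0// ltW.
  rewrite {2 3}xE; move: (Num.sqrt x) y0 => y y0.
  rewrite lnXn// mulr2n.
  have := @ln_sublinear R y^-1; rewrite invr_gt0 lnV ?posrE// => /(_ y0) H.
  have : - ln y * y ^+ 2 <= y^-1 * y ^+ 2.
    by apply: ler_wpM2r; [exact: sqr_ge0|exact: ltW].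
  rewrite expr2 mulrA mulrA mulVf ?gt_eqF// mul1r; lra.
- rewrite -[X in _ --> X](mulr0 (- 2)); apply: cvgM => //; exact: cvg_cst.
- exact: cvg_cst.
Unshelve. all: by end_near. Qed.

Let num x : R := (1 - x) + x * ln x.
Let den x : R := (x - 1) ^+ 2.

Let num_derive x : 0 < x -> is_derive x 1 num (ln x).
Proof.
move=> x0; have := is_derive1_ln x0 => H.
rewrite /num; apply: is_derive_eq; rewrite /= /GRing.scale/=.
by field; rewrite gt_eqF.
Qed.

Let den_derive x : is_derive x 1 den (2 * (x - 1)).
Proof.
rewrite /den; apply: is_derive_eq; rewrite /= /GRing.scale/=; ring.
Qed.

Let cvg_num1 : num x @[x --> (1:R)] --> (0:R).
Proof.
have -> : 0 = num 1 by rewrite /num ln1; ring.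
by apply: differentiable_continuous; apply/derivable1_diffP; case: (num_derive ltr01).
Qed.

Let cvg_den1 : den x @[x --> (1:R)] --> (0:R).
Proof.
have -> : 0 = den 1 by rewrite /den; ring.
by apply: differentiable_continuous; apply/derivable1_diffP; case: (den_derive 1).
Qed.

Let dd_derive x : is_derive x 1 (fun y : R => 2 * (y - 1)) (2:R).
Proof. by apply: is_derive_eq; rewrite /= /GRing.scale/=; ring. Qed.

Let cvg_ln1 : ln x @[x --> (1:R)] --> (0:R).
Proof. by rewrite -[X in _ --> X](@ln1 R); apply: continuous_ln. Qed.

Let cvg_dd1 : 2 * (x - 1) @[x --> (1:R)] --> (0:R).
Proof.
have -> : 0 = 2 * (1 - 1) :> R by ring.
by apply: (@differentiable_continuous _ _ _ _ (fun y : R => 2 * (y - 1)));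
  apply/derivable1_diffP; case: (dd_derive 1).
Qed.

Let cvg_inv1 : x^-1 / 2 @[x --> (1:R)] --> (2^-1:R).
Proof.
rewrite -[X in _ --> X](mul1r); apply: cvgM; last exact: cvg_cst.
by rewrite -[X in _ --> X](@invr1 R); apply: cvgV; [exact: oner_neq0|exact: cvg_id].
Qed.

Lemma fexpr_cvg1r : fexpr x @[x --> (1:R)^'+] --> (2^-1:R).
Proof.
apply: (@lhopital_at_right R num (@ln R) den (fun x => 2 * (x - 1)) 1 2).
- lra.
- by move=> x; rewrite in_itv/= => /andP[x1 _]; apply: num_derive; lra.
- by [].
- exact: cvg_at_right_filter.
- exact: cvg_at_right_filter.
- by move=> x; rewrite in_itv/= => /andP[x1 _]; rewrite mulf_neq0// subr_eq0 gt_eqF.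
apply: (@lhopital_at_right R (@ln R) (fun x => x^-1) _ (fun=> 2) 1 2).
- lra.
- by move=> x; rewrite in_itv/= => /andP[x1 _]; apply: is_derive1_ln; lra.
- by move=> x _; exact: dd_derive.
- exact: cvg_at_right_filter.
- exact: cvg_at_right_filter.
- by [].
- exact: cvg_at_right_filter.
Qed.

Lemma fexpr_cvg1l : fexpr x @[x --> (1:R)^'-] --> (2^-1:R).
Proof.
apply: (@lhopital_at_left R num (@ln R) den (fun x => 2 * (x - 1)) 2^-1 1).
- lra.
- by move=> x; rewrite in_itv/= => /andP[x1 _]; apply: num_derive; lra.
- by [].
- exact: cvg_at_left_filter.
- exact: cvg_at_left_filter.
- by move=> x; rewrite in_itv/= => /andP[_ x1]; rewrite mulf_neq0// subr_eq0 lt_eqF.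
apply: (@lhopital_at_left R (@ln R) (fun x => x^-1) _ (fun=> 2) 2^-1 1).
- lra.
- by move=> x; rewrite in_itv/= => /andP[x1 _]; apply: is_derive1_ln; lra.
- by move=> x _; exact: dd_derive.
- exact: cvg_at_left_filter.
- exact: cvg_at_left_filter.
- by [].
- exact: cvg_at_left_filter.
Qed.

Lemma fexpr_ge0 x : 0 < x -> 0 <= fexpr x.
Proof.
move=> x0; rewrite /fexpr divr_ge0 ?sqr_ge0//.
have xV : 0 < x^-1 by rewrite invr_gt0.
have := @le_ln1Dx R (x^-1 - 1); rewrite addrCA subrr addr0 lnV ?posrE//.
have -> : -1 < x^-1 - 1 by lra.
move=> /(_ isT) H.
have : x * - ln x <= x * (x^-1 - 1) by rewrite ler_pM2l.
rewrite mulrBr mulfV ?gt_eqF//; lra.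
Qed.

Lemma fext_exists : exists f : R -> R,
  [/\ is_fext f, f 0 = 1, f 1 = 2^-1 & forall x, 0 <= x -> 0 <= f x].
Proof.
pose f x : R := if x == 0 then 1 else if x == 1 then 2^-1 else fexpr x.
have f0 : f 0 = 1 by rewrite /f eqxx.
have f1 : f 1 = 2^-1 by rewrite /f oner_eq0 eqxx.
have fE x : x != 0 -> x != 1 -> f x = fexpr x.
  by rewrite /f => /negPf -> /negPf ->.
exists f; split => //; last first.
  move=> x x0; rewrite /f; case: eqVneq => [//|xn0]; case: eqVneq => _ //.
  by apply: fexpr_ge0; rewrite lt_neqAle eq_sym xn0.
split; last by move=> x _; exact: fE.
apply/continuous_within_itvcyP; split; last first.
  rewrite f0; have -> : 1 = ((1 - 0) + 0) / (0 - 1) ^+ 2 :> R by field.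
  have: fexpr x @[x --> (0:R)^'+] --> (((1 - 0) + 0) / (0 - 1) ^+ 2 : R).
    apply: cvgM.
      apply: cvgD; last exact: xlnx_cvg0.
      by apply: cvgB; [exact: cvg_cst|exact: cvg_at_right_filter].
    apply: cvgV; first by rewrite sub0r sqrrN expr1n oner_neq0.
    rewrite expr2; apply: cvgM; apply: cvgB; try exact: cvg_cst;
      exact: cvg_at_right_filter.
  apply: cvg_trans; apply: near_eq_cvg; near=> x.
  have x0 : 0 < x by near: x; exact: nbhs_right_gt.
  have x1 : x < 1 by near: x; exact: nbhs_right_lt.
  by rewrite fE// ?(gt_eqF x0) ?(lt_eqF x1).
move=> x; rewrite in_itv/= andbT => x0.
have [->|xn1] := eqVneq x 1.
  apply/left_right_continuousP; rewrite f1; split.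
    apply: cvg_trans fexpr_cvg1l; apply: near_eq_cvg; near=> y.
    have y0 : 0 < y by near: y; exact: nbhs_left_gt.
    have y1 : y < 1 by near: y; exact: nbhs_left_lt.
    by rewrite fE// ?(gt_eqF y0) ?(lt_eqF y1).
  apply: cvg_trans fexpr_cvg1r; apply: near_eq_cvg; near=> y.
  have y1 : 1 < y by near: y; exact: nbhs_right_gt.
  by rewrite fE// ?gt_eqF// (lt_trans _ y1).
rewrite /continuous_at fE ?(gt_eqF x0)//.
have: fexpr y @[y --> x] --> fexpr x.
  have xB : (x - 1) ^+ 2 != 0 by rewrite sqrf_eq0 subr_eq0.
  apply: cvgM; last first.
    apply: cvgV => //; have [+ _] := den_derive x.
    by move=> /derivable1_diffP/differentiable_continuous.
  by have [/derivable1_diffP/differentiable_continuous] := num_derive x0.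
apply: cvg_trans; apply: near_eq_cvg; near=> y.
have y0 : 0 < y by near: y; exact: lt_nbhsr.
have y1 : y != 1 by near: y; exact: open_nbhs_nbhs (conj (@open_neq _ 1) xn1).
by rewrite fE// gt_eqF.
Unshelve. all: by end_near. Qed.

End WellDefinedness.

(* Main.v *)
Require Import Defs.
From HB Require Import structures.
From mathcomp Require Import all_boot all_order all_algebra.
From mathcomp Require Import all_classical all_reals all_analysis.
From mathcomp Require Import ring lra.

Set Implicit Arguments.
Unset Strict Implicit.
Unset Printing Implicit Defensive.

Import Order.TTheory GRing.Theory Num.Theory.
Import numFieldNormedType.Exports.

Local Open Scope ring_scope.

(** Write a(u) = w(N(u)), x(u) = a(u) / w(u) and W = w(V).  Pick a vertex v with
    probability w(v) / W, put it in I, delete v and N(v), and recurse with the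
    same weights.  Since f is convex and satisfies
    x (x - 1) f'(x) + (x + 1) f(x) = 1, and since G is triangle-free, this
    contains u with probability at least f(x(u)) - f'(x(u)) D(u), where D(u) is
    the derivative of x(u) when the weights follow the flow dw/ds = w a / W.
    Hence mixing the greedy step, with small weight d, with a distribution for
    the weights after one Euler step of length d compensates the drift up to
    d^2: if every weight function admits a distribution with deficit at most
    eps, then also one with deficit at most (eps + d^2) / (1 + d).  Taking
    d = 2 / n turns deficit 8 / n into 8 / (n + 1), and compactness of the
    simplex of distributions gives deficit 0.  Convexity of f comes from
    f(x) = \int_0^1 (1 - s) / (1 + s (x - 1)) ds. *)

(** * Integrals over [0, 1] described by primitives *)

Section Primitive01.
Context {R : realType}.
Local Open Scope classical_set_scope.
Local Open Scope ring_scope.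
Implicit Types (g h : R -> R) (a c d : R).

(** Stands for [\int_0^1 g = c]; monotonicity then reduces to the sign of a derivative. Nothing is
    asked of [g] at the endpoints, so an integrand may take a junk value there. *)
Definition integral01 g c : Prop := exists K : R -> R,
  [/\ {within `[0, 1]%classic, continuous K},
      forall s : R, 0 < s < 1 -> is_derive s 1 K (g s) & K 1 - K 0 = c].

Lemma integral01_ge0 g c :
  (forall s : R, 0 < s < 1 -> 0 <= g s) -> integral01 g c -> 0 <= c.
Proof.
move=> g0 [K [cK dK <-]]; rewrite subr_ge0.
apply: (@ger0_derive1_le_cc _ K 0 1) => //; rewrite ?in_itv/= ?lexx ?ler01//.
- by move=> s; rewrite in_itv => /= /dK [].
- move=> s; rewrite in_itv => /= s01; rewrite derive1E.
  by have [_ ->] := dK _ s01; exact: g0.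
Qed.

Lemma integral01_lin g h a c d : integral01 g c -> integral01 h d ->
  integral01 (fun s => g s + a * h s) (c + a * d).
Proof.
move=> [K [cK dK <-]] [L [cL dL <-]].
exists (fun s => K s + a * L s); split; last by ring.
  by move=> s; apply: cvgD; [exact: cK|apply: cvgM; [exact: cvg_cst|exact: cL]].
move=> s s01; have := dK _ s01 => ?; have := dL _ s01 => ?.
by apply: is_derive_eq; rewrite /= /GRing.scale/=; ring.
Qed.

Lemma integral01_le g h c d : (forall s : R, 0 < s < 1 -> g s <= h s) ->
  integral01 g c -> integral01 h d -> c <= d.
Proof.
move=> gh ic id; rewrite -subr_ge0 -(mulN1r c).
by apply: integral01_ge0 (integral01_lin _ id ic) => s /gh; lra.
Qed.

Lemma integral01_derive K g c :
  (forall s : R, 0 <= s <= 1 -> is_derive s 1 K (g s)) -> K 1 - K 0 = c ->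
  integral01 g c.
Proof.
move=> dK Kc; exists K; split=> //; last first.
  by move=> s /andP[s0 s1]; apply: dK; rewrite !ltW.
by apply: derivable_within_continuous => s; rewrite in_itv => /= /dK [].
Qed.

Lemma integral01_cst a : integral01 (fun=> a) a.
Proof.
apply: (@integral01_derive (fun s => a * s)); last by ring.
by move=> s _; apply: is_derive_eq; rewrite /= /GRing.scale/=; ring.
Qed.

Lemma integral01_eq g h c :
  (forall s : R, 0 < s < 1 -> g s = h s) -> integral01 g c -> integral01 h c.
Proof.
by move=> gh [K [cK dK <-]]; exists K; split=> // s s01; rewrite -gh //; exact: dK.
Qed.

End Primitive01.

(** * Integral representation, convexity and differential equation of [f] *)

Section FExt.
Context {R : realType}.
Variables (f : R -> R) (hf : is_fext f).
Implicit Types x y s : R.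

(* The value at [0] is junk: the right derivative of [f] there is -oo. *)
Definition fderiv x : R :=
  if x == 0 then 0 else if x == 1 then - (1 / 6)
  else 2 / (x - 1) ^+ 2 - (x + 1) * ln x / (x - 1) ^+ 3.

Lemma fext0 : f 0 = 1.
Proof.
have [g [hg <- _ _]] := @fext_exists R.
by apply: (fext_unique hf hg); rewrite in_itv/= lexx.
Qed.

Lemma fext1 : f 1 = 2^-1.
Proof.
have [g [hg _ <- _]] := @fext_exists R.
by apply: (fext_unique hf hg); rewrite in_itv/= ler01.
Qed.

Lemma denom_gt0 x s : 0 <= x -> 0 < s < 1 -> 0 < 1 + s * (x - 1).
Proof. by move=> x0 /andP[s0 s1]; nra. Qed.

Lemma denom_gt0W x s : 0 < x -> 0 <= s <= 1 -> 0 < 1 + s * (x - 1).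
Proof. by move=> x0 /andP[s0 s1]; nra. Qed.

Lemma is_derive_ln_denom x s : 0 < x -> 0 <= s <= 1 ->
  is_derive s 1 (fun s => ln (1 + s * (x - 1))) ((x - 1) / (1 + s * (x - 1))).
Proof.
move=> x0 s01; have d0 := denom_gt0W x0 s01.
have dl := is_derive1_ln d0.
have di : is_derive s 1 (fun s => 1 + s * (x - 1)) (x - 1).
  by apply: is_derive_eq; rewrite /= /GRing.scale/=; ring.
have := @is_derive1_comp _ _ (fun s => 1 + s * (x - 1)) _ _ _ dl di; rewrite /comp => H.
by apply: is_derive_eq; rewrite mulrC.
Qed.

Lemma integral01_fext y : 0 <= y ->
  integral01 (fun s => (1 - s) / (1 + s * (y - 1))) (f y).
Proof.
move=> y0; have [->|yn0] := eqVneq y 0.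
  (* At [y = 0] the integrand is 1 except at [s = 1], where it reads 0 / 0 = 0. *)
  rewrite fext0; apply: (@integral01_eq _ (fun=> 1)).
    by move=> s /andP[s0 s1]; field; lra.
  by apply: (@integral01_derive _ id); rewrite ?subr0// => s _; exact: is_derive_id.
have [->|yn1] := eqVneq y 1.
  rewrite fext1; apply: (@integral01_derive _ (fun s => s - s ^+ 2 / 2)); last by field.
  move=> s _; apply: is_derive_eq; rewrite /= /GRing.scale/=; field.
  by [].
have {y0 yn0} y0 : 0 < y by rewrite lt_neqAle eq_sym yn0.
have h0 : y - 1 != 0 by rewrite subr_eq0.
rewrite (hf.2 _ (ltW y0) (lt0r_neq0 y0) yn1) /fexpr.
(* Primitive from the partial fractions of the integrand in [s]. *)
apply: (@integral01_derive _
  (fun s => - s / (y - 1) + y / (y - 1) ^+ 2 * ln (1 + s * (y - 1)))).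
  move=> s s01; have := is_derive_ln_denom y0 s01 => ?.
  apply: is_derive_eq; rewrite /= /GRing.scale/=.
  by have := denom_gt0W y0 s01 => d0; field; rewrite h0 gt_eqF.
have -> : 1 + 1 * (y - 1) = y by ring.
have -> : 1 + 0 * (y - 1) = 1 by ring.
by rewrite ln1; field; rewrite h0.
Qed.

(** The integrand is the [x]-derivative of the one for [f]. This formula replaces differentiation
    under the integral sign: [f] itself is never differentiated. *)
Lemma integral01_fderiv x : 0 < x ->
  integral01 (fun s => - ((1 - s) * s / (1 + s * (x - 1)) ^+ 2)) (fderiv x).
Proof.
move=> x0; rewrite /fderiv gt_eqF//.
have [->|xn1] := eqVneq x 1.
  apply: (@integral01_derive _ (fun s => s ^+ 3 / 3 - s ^+ 2 / 2)); last by field.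
  move=> s _; apply: is_derive_eq; rewrite /= /GRing.scale/=; field.
  by [].
have h0 : x - 1 != 0 by rewrite subr_eq0.
apply: (@integral01_derive _
  (fun s => s / (x - 1) ^+ 2 - (x + 1) / (x - 1) ^+ 3 * ln (1 + s * (x - 1))
            - x / (x - 1) ^+ 3 * (1 + s * (x - 1))^-1)).
  move=> s s01; have := is_derive_ln_denom x0 s01 => ?.
  have d0 := denom_gt0W x0 s01; have dn0 : 1 + s * (x - 1) != 0 by rewrite gt_eqF.
  have di : is_derive s 1 (fun s => 1 + s * (x - 1)) (x - 1).
    by apply: is_derive_eq; rewrite /= /GRing.scale/=; ring.
  have := @is_deriveV _ (fun s => 1 + s * (x - 1)) _ _ _ dn0 di => ?.
  apply: is_derive_eq; rewrite /= /GRing.scale/=.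
  by field; rewrite h0 dn0.
have -> : 1 + 1 * (x - 1) = x by ring.
have -> : 1 + 0 * (x - 1) = 1 by ring.
by rewrite ln1; field; rewrite h0 gt_eqF.
Qed.

Lemma fext_ode x : 0 <= x -> x * (x - 1) * fderiv x + (x + 1) * f x = 1.
Proof.
move=> x0; rewrite /fderiv; have [->|xn0] := eqVneq x 0.
  by rewrite fext0; ring.
have [->|xn1] := eqVneq x 1; first by rewrite fext1; field.
by rewrite (hf.2 _ x0)// /fexpr; field; rewrite subr_eq0.
Qed.

Lemma fderiv_le0 x : 0 <= x -> fderiv x <= 0.
Proof.
rewrite le_eqVlt => /predU1P[<-|x0]; first by rewrite /fderiv eqxx.
apply: integral01_le (integral01_fderiv x0) (integral01_cst 0) => s s01.
have d0 := denom_gt0 (ltW x0) s01; case/andP: s01 => s0 s1.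
by rewrite oppr_le0 divr_ge0 ?mulr_ge0 ?sqr_ge0//; lra.
Qed.

Lemma fext_ge0 x : 0 <= x -> 0 <= f x.
Proof.
move=> x0; apply: integral01_ge0 (integral01_fext x0) => s s01.
have d0 := denom_gt0 x0 s01; case/andP: s01 => s0 s1.
by rewrite divr_ge0 ?ltW//; lra.
Qed.

(** Convexity holds already between the integrands, whose difference is a square times a nonnegative
    factor. The last hypothesis keeps away from the vertical tangent at 0. *)
Lemma fext_tangent x y : 0 <= x -> 0 <= y -> (x = 0 -> y = 0) ->
  f x + fderiv x * (y - x) <= f y.
Proof.
rewrite le_eqVlt => /predU1P[<- _ /(_ erefl) ->|x0 y0 _].
  by rewrite subrr mulr0 addr0.
rewrite mulrC.
apply: integral01_le (integral01_lin (y - x) (integral01_fext (ltW x0))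
  (integral01_fderiv x0)) (integral01_fext y0) => s s01.
have dx := denom_gt0 (ltW x0) s01; have dy := denom_gt0 y0 s01.
case/andP: s01 => s0 s1; rewrite -subr_ge0.
have -> : (1 - s) / (1 + s * (y - 1)) - ((1 - s) / (1 + s * (x - 1)) +
    (y - x) * - ((1 - s) * s / (1 + s * (x - 1)) ^+ 2)) =
  (1 - s) * (s * (y - x) / (1 + s * (x - 1))) ^+ 2 / (1 + s * (y - 1)).
  by field; rewrite !gt_eqF.
by apply: divr_ge0 (ltW dy); apply: mulr_ge0 (sqr_ge0 _); lra.
Qed.

(** The tangent at [x], evaluated at 0, where [f] is 1. *)
Lemma fderiv_bound x : 0 <= x -> - (x * fderiv x) <= 1 - f x.
Proof.
move=> x0; have [->|xn0] := eqVneq x 0; first by rewrite fext0; lra.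
by have := fext_tangent x0 (lexx 0) (fun _ => erefl); rewrite fext0; lra.
Qed.

End FExt.

(** * Inclusion probabilities realised by random independent sets *)

Section Attainable.
Context {R : realType} {T : finType} (e : rel T).
Local Open Scope classical_set_scope.
Local Open Scope ring_scope.
Implicit Types (S I : {set T}) (p : T -> R) (D : {ffun {set T} -> R}).

(** Distributions for the subgraph induced on [S] remain distributions on [{set T}], so the
    recursion never changes the vertex type. *)
Definition attainable S p : Prop := exists D,
  [/\ indep_distribution e D, forall I, D I != 0 -> I \subset S
    & forall u, u \in S -> p u <= prob D (fun I => u \in I)].

Lemma attainable_le S p q :
  (forall u, u \in S -> q u <= p u) -> attainable S p -> attainable S q.
Proof.
move=> qp [D [hD DS Dp]]; exists D; split=> // u uS.
exact: le_trans (qp _ uS) (Dp _ uS).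
Qed.

(** The point mass at the empty set suffices. *)
Lemma attainable_le0 S p : (forall u, u \in S -> p u <= 0) -> attainable S p.
Proof.
move=> p0; exists [ffun I => (I == finset.set0)%:R]; split.
- split=> [I||I]; rewrite ?ffunE ?ler0n//.
    rewrite (bigD1 finset.set0)//= big1 ?addr0 ?ffunE ?eqxx// => I /negPf I0.
    by rewrite ffunE I0.
  by case: (eqVneq I finset.set0) => [-> _ x y|]; rewrite ?inE ?eqxx.
- by move=> I; rewrite ffunE; case: (eqVneq I finset.set0) => [->|]; rewrite ?finset.sub0set ?eqxx.
- move=> u /p0 /le_trans; apply; apply: sumr_ge0 => I _.
  by rewrite ffunE ler0n.
Qed.

Lemma attainable_mix (J : finType) (A : {set J}) (c : J -> R) (p : J -> T -> R) S :
  (forall j, j \in A -> 0 <= c j) -> \sum_(j in A) c j = 1 ->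
  (forall j, j \in A -> attainable S (p j)) ->
  attainable S (fun u => \sum_(j in A) c j * p j u).
Proof.
move=> c0 c1 hp.
have /choice[D DP] : forall j, exists D, j \in A ->
    [/\ indep_distribution e D, forall I, D I != 0 -> I \subset S
      & forall u, u \in S -> p j u <= prob D (fun I => u \in I)].
  move=> j; have [jA|jA] := boolP (j \in A); last by exists [ffun=> 0].
  by have [D hD] := hp _ jA; exists D.
pose E := [ffun I => \sum_(j in A) c j * D j I].
have supp I : E I != 0 -> exists2 j, j \in A & D j I != 0.
  rewrite ffunE => EI; have [/exists_inP//|] := boolP [exists j in A, D j I != 0].
  rewrite negb_exists_in => /forall_inP H; move: EI.
  rewrite big1 ?eqxx// => j /H; rewrite negbK => /eqP ->.
  by rewrite mulr0.
exists E; split.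
- split=> [I||I /supp[j jA]].
  + rewrite ffunE; apply: sumr_ge0 => j jA.
    by apply: mulr_ge0; [exact: c0|have [[]] := DP _ jA].
  + under eq_bigr do rewrite ffunE.
    rewrite exchange_big/= -c1; apply: eq_bigr => j jA.
    by rewrite -mulr_sumr; have [[_ -> _] _ _] := DP _ jA; rewrite mulr1.
  + by have [[_ _ +] _ _] := DP _ jA => /[apply].
- by move=> I /supp[j jA]; have [_ + _] := DP _ jA => /[apply].
- move=> u uS; rewrite /prob; under [X in _ <= X]eq_bigr do rewrite ffunE.
  rewrite [X in _ <= X]exchange_big/=; apply: ler_sum => j jA.
  rewrite -mulr_sumr; apply: ler_wpM2l; first exact: c0.
  by have [_ _ +] := DP _ jA => /(_ _ uS).
Qed.

Lemma attainable_mix2 S p q (d : R) : 0 <= d ->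
  attainable S p -> attainable S q ->
  attainable S (fun u => (d * p u + q u) / (1 + d)).
Proof.
move=> d0 hp hq; have d1 : 1 + d != 0 by lra.
pose c b : R := (if b then d else 1) / (1 + d).
apply: attainable_le (@attainable_mix bool [set: bool]%SET c (fun b => if b then p else q) S _ _ _).
- move=> u _; rewrite (eq_bigl predT) => [|b]; last by rewrite inE.
  by rewrite big_bool/c/= le_eqVlt; apply/orP; left; apply/eqP; field.
- by move=> [] _; rewrite /c divr_ge0//; lra.
- rewrite (eq_bigl predT) => [|b]; last by rewrite inE.
  by rewrite big_bool/c/=; field.
- by move=> [] _.
Qed.

(** Push the distribution forward along the map from [I] to [v |: I], which stays independent
    because [I] avoids the neighbours of [v]. *)
Lemma attainable_add (v : T) S p : symmetric e -> irreflexive e -> v \in S ->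
  attainable [set u in S | (u != v) && ~~ e v u]%SET p ->
  attainable S (fun u => if u == v then 1 else if e v u then 0 else p u).
Proof.
move=> e_sym e_irr vS [D [[D0 D1 Dind] DS Dp]].
pose E := [ffun J => \sum_(I : {set T} | v |: I == J) D I].
have supp J : E J != 0 -> exists2 I, J = v |: I & D I != 0.
  rewrite ffunE => EJ.
  have [/exists_inP[I /eqP <- DI]|] :=
    boolP [exists I : {set T} in [pred I : {set T} | v |: I == J], D I != 0].
    by exists I.
  rewrite negb_exists_in => /forall_inP H; move: EJ.
  by rewrite big1 ?eqxx// => I /H; rewrite negbK => /eqP.
have probE (Q : pred {set T}) : prob E Q = prob D (fun I => Q (v |: I)).
  rewrite /prob [RHS](partition_big (fun I => v |: I) Q)//=.
  apply: eq_bigr => J QJ; rewrite ffunE; apply: eq_bigl => I.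
  by case: eqVneq => [->|]; rewrite ?QJ ?andbF.
have DSv I : D I != 0 -> forall u, u \in I -> [/\ u \in S, u != v & ~~ e v u].
  move=> /DS/fintype.subsetP IS u /IS; rewrite !inE => /and3P[]; by split.
exists E; split.
- split=> [J||J /supp[I -> DI]].
  + by rewrite ffunE; apply: sumr_ge0.
  + by have := probE predT; rewrite /prob/= D1.
  + move=> x y; rewrite !inE => /predU1P[->|xI] /predU1P[->|yI].
    * by rewrite e_irr.
    * by have [] := DSv _ DI _ yI.
    * by rewrite e_sym; have [] := DSv _ DI _ xI.
    * exact: Dind DI _ _ xI yI.
- move=> J /supp[I -> DI]; apply/fintype.subsetP => u; rewrite !inE => /predU1P[->//|uI].
  by have [] := DSv _ DI _ uI.
- move=> u uS; rewrite probE /prob; case: eqVneq => [->|uv].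
    rewrite -D1 le_eqVlt; apply/orP; left; apply/eqP.
    by apply: eq_bigl => I; rewrite !inE eqxx.
  have [euv|euv] := boolP (e v u); first exact: sumr_ge0.
  have := Dp u; rewrite !inE uS uv euv => /(_ isT) /le_trans; apply.
  rewrite /prob le_eqVlt; apply/orP; left; apply/eqP.
  by apply: eq_bigl => I; rewrite !inE (negPf uv).
Qed.

(** By Tychonoff the [D n] have a cluster point in the cube of functions from [{set T}] to [0, 1];
    the requirements pass to it as closed conditions on finite sums of coordinates. *)
Lemma attainable_closed S p (b : R^nat) : b @ \oo --> (0 : R) ->
  (forall n, attainable S (fun u => p u - b n)) -> attainable S p.
Proof.
move=> b0 /choice[D DP].
pose Dn (n : nat) : {ptws {set T} -> R} := D n.
have [] := @tychonoff {set T} (fun=> R) (fun=> `[0, 1]%classic) _ (Dn @ \oo) _ _.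
- by move=> i; exact: segment_compact.
- exists 0%N => // n _ I /=; rewrite in_itv/=.
  have [[D0 D1 _] _ _] := DP n; rewrite D0/= -D1 (bigD1 I)//= lerDl.
  by apply: sumr_ge0.
move=> E [_ clE].
have lim (A : set R) (Q : pred {set T}) : closed A ->
    (\forall n \near \oo, A (prob (D n) Q)) -> A (\sum_(I | Q I) E I).
  move=> cA nA; pose phi (F : {ptws {set T} -> R}) : R := \sum_(I | Q I) F I.
  have cphi : continuous phi.
    apply: (@continuous_big R {set T} +%R 0 Q _ {ptws {set T} -> R} _
      (fun I (F : {ptws {set T} -> R}) => F I)); first exact: add_continuous.
    by move=> I _; exact: (@proj_continuous _ (fun=> R) I).
  move: clE; rewrite clusterE => /(_ (phi @^-1` A)) H.
  have : closure (phi @^-1` A) E by apply: H.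
  have /closure_id <- : closed (phi @^-1` A) by apply: preimage_closed.
  by [].
have lim1 (A : set R) I : closed A ->
    (\forall n \near \oo, A (D n I)) -> A (E I).
  move=> cA nA; have := lim A (pred1 I) cA; rewrite big_pred1_eq; apply.
  by apply: filterS nA => n; rewrite /prob big_pred1_eq.
have EI0 I : (forall n, D n I = 0) -> E I = 0.
  by move=> DI; apply: (lim1 [set x | x = 0]) => //; exact: nearW.
(* A set charged by the limit is charged by some [D n], hence is independent and contained in
   [S]. *)
have supp I : E I != 0 -> exists n, D n I != 0.
  move=> EI; apply: contrapT => nD; move/eqP: EI; apply; apply: EI0 => n.
  by apply/eqP; apply: contrapT => /negP DI; apply: nD; exists n.
exists (finfun E); split.
- split.
  + move=> I; rewrite ffunE; apply: (lim1 [set x | 0 <= x]); first exact: closed_ge.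
    by apply: nearW => n; have [[D0 _ _] _ _] := DP n; exact: D0.
  + under eq_bigr do rewrite ffunE.
    apply: (lim [set x | x = 1] predT); first exact: closed_eq.
    by apply: nearW => n; have [[_ D1 _] _ _] := DP n; exact: D1.
  + by move=> I; rewrite ffunE => /supp[n]; have [[_ _ +] _ _] := DP n; exact.
- by move=> I; rewrite ffunE => /supp[n]; have [_ + _] := DP n; exact.
- move=> u uS; rewrite /prob; under eq_bigr do rewrite ffunE.
  apply/ler_addgt0Pr => eps eps0; rewrite -lerBlDr.
  apply: (lim [set x | p u - eps <= x]) => //.
  have /cvgrPdist_lt/(_ _ eps0) := b0; apply: filterS => n /=.
  rewrite sub0r normrN => bn; have [_ _ /(_ _ uS)] := DP n.
  by apply: le_trans; rewrite lerD2l lerN2 ltW// (le_lt_trans (ler_norm _)).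
Qed.

End Attainable.

(** * Neighbourhood weights and the greedy step *)

Section WeightFlow.
Context {R : realType} {T : finType}.
Variables (f : R -> R) (hf : is_fext f) (e : rel T).
Hypotheses (e_sym : symmetric e) (e_irr : irreflexive e) (e_tf : triangle_free e).
Implicit Types (S : {set T}) (w : T -> R) (u v t : T) (d : R).

Definition nbr_weight w S u : R := \sum_(t in S | e u t) w t.

Definition nbr_ratio w S u : R := nbr_weight w S u / w u.

(* The time derivative of [nbr_ratio w S u] under the flow
   w' t = w t * nbr_weight w S t / weight w S. *)
Definition drift w S u : R :=
  (\sum_(t in S | e u t) w t * nbr_weight w S t - nbr_weight w S u ^+ 2)
    / (weight w S * w u).

Lemma nbr_weight_ge0 w S u : (forall v, 0 < w v) -> 0 <= nbr_weight w S u.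
Proof. by move=> w0; apply: sumr_ge0 => t _; exact: ltW. Qed.

Lemma nbr_ratio_ge0 w S u : (forall v, 0 < w v) -> 0 <= nbr_ratio w S u.
Proof. by move=> w0; rewrite divr_ge0 ?nbr_weight_ge0// ltW. Qed.

Lemma nbr_weight_le w S u : (forall v, 0 < w v) -> nbr_weight w S u <= weight w S.
Proof.
move=> w0; rewrite /nbr_weight big_mkcondr; apply: ler_sum => t _.
by case: ifP => // _; exact: ltW.
Qed.

Lemma weight_gt0 w S u : (forall v, 0 < w v) -> u \in S -> 0 < weight w S.
Proof.
move=> w0 uS; rewrite /weight (bigD1 u)//= ltr_pwDl//.
by apply: sumr_ge0 => t _; exact: ltW.
Qed.

Let remaining S v : {set T} := [set u in S | (u != v) && ~~ e v u]%SET.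

Lemma nbr_weight_remaining w S u v : ~~ e v u ->
  nbr_weight w (remaining S v) u =
  nbr_weight w S u - \sum_(t in S | e u t && e v t) w t.
Proof.
move=> nevu; rewrite /nbr_weight [in RHS](bigID (e v)) /=.
under [X in _ = _ - X]eq_bigl do rewrite andbA.
rewrite addrC addrK; apply: eq_bigl => t; rewrite !inE -!andbA.
case: (t \in S) => //=; have [->|_] := eqVneq t v; last by rewrite /= andbC.
by rewrite e_sym (negPf nevu).
Qed.

(** Double counting of the paths from [u] through [t] to [v]; it turns the average loss of neighbour
    weight into the first term of [drift]. *)
Lemma sum_common_nbr w S u :
  \sum_(v in S) w v * \sum_(t in S | e u t && e v t) w t =
  \sum_(t in S | e u t) w t * nbr_weight w S t.
Proof.
under eq_bigr do rewrite mulr_sumr.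
rewrite (exchange_big_dep (fun t => (t \in S) && e u t))/=; last first.
  by move=> v t _ /and3P[-> ->].
apply: eq_bigr => t /andP[tS ut]; rewrite /nbr_weight mulr_sumr.
under eq_bigr do rewrite mulrC.
by apply: eq_bigl => v; rewrite tS ut /= e_sym.
Qed.

(** A common neighbour would close a triangle; this is where triangle-freeness enters. *)
Lemma common_nbr_adjacent w S u v : e v u ->
  \sum_(t in S | e u t && e v t) w t = 0.
Proof.
move=> vu; rewrite big_pred0// => t; apply/negP => /and3P[_ ut vt].
by apply: e_tf; exists v, u, t.
Qed.

Lemma attainable_greedy w S : (forall v, 0 < w v) -> S != finset.set0 ->
  (forall v, v \in S ->
    attainable e (remaining S v) (fun u => f (nbr_ratio w (remaining S v) u))) ->
  attainable e S (fun u => f (nbr_ratio w S u)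
                           - fderiv (nbr_ratio w S u) * drift w S u).
Proof.
move=> w0 /finset.set0Pn[v0 v0S] IH; have W0 := weight_gt0 w0 v0S.
set W := weight w S in W0 *.
pose p v u := if u == v then 1 else if e v u then 0 else
  f (nbr_ratio w (remaining S v) u).
apply: attainable_le (@attainable_mix _ _ e _ S (fun v => w v / W) p S _ _ _).
- move=> u uS; set x := nbr_ratio w S u; set a := nbr_weight w S u.
  have x0 : 0 <= x by exact: nbr_ratio_ge0.
  have wu0 := w0 u; have aE : a = x * w u by rewrite /x /nbr_ratio divfK ?gt_eqF.
  pose b v := \sum_(t in S | e u t && e v t) w t.
  pose q v := f x - fderiv x * b v / w u
    + (u == v)%:R * (1 - f x + fderiv x * x) - (e v u)%:R * f x.
  have qp v : v \in S -> q v <= p v u.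
    move=> vS; rewrite /q /p; case: eqVneq => [<-|uv].
      have -> : b u = x * w u by rewrite -aE; apply: eq_bigl => t; rewrite andbb.
      by rewrite e_irr mulrA mulfK ?gt_eqF// mul0r mul1r; lra.
    case: (boolP (e v u)) => vu.
      by rewrite /b common_nbr_adjacent// mulr0 !mul0r mul1r; lra.
    have yE : nbr_ratio w (remaining S v) u = x - b v / w u.
      by rewrite /nbr_ratio nbr_weight_remaining// mulrBl.
    have y0 : 0 <= x - b v / w u by rewrite -yE; exact: nbr_ratio_ge0.
    have b0 : 0 <= b v / w u.
      by rewrite divr_ge0 ?(ltW wu0)//; apply: sumr_ge0 => t _; exact: ltW.
    rewrite yE !mul0r.
    (* If [x = 0], then [y0] and [b0] force the new ratio to be 0 too. *)
    by have := @fext_tangent _ _ hf _ _ x0 y0 (fun _ => ltac:(lra)); lra.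
  apply: (@le_trans _ _ (\sum_(v in S) w v / W * q v)); last first.
    by apply: ler_sum => v vS; rewrite ler_wpM2l ?qp// divr_ge0 ?ltW.
  under eq_bigr do rewrite mulrAC.
  rewrite -mulr_suml ler_pdivlMr//.
  have -> : \sum_(v in S) w v * q v = W * f x
      - fderiv x / w u * (\sum_(v in S) w v * b v)
      + w u * (1 - f x + fderiv x * x) - a * f x.
    transitivity (\sum_(v in S) (w v * f x + - (fderiv x / w u) * (w v * b v)
        + (if u == v then w v * (1 - f x + fderiv x * x) else 0)
        + (if e u v then - (w v * f x) else 0))).
      apply: eq_bigr => v _; rewrite /q e_sym.
      by case: eqP; case: ifP => _ _ /=; field; rewrite gt_eqF.
    rewrite !big_split/= -!big_mkcondr/= sumrN -mulr_sumr mulNr -!mulr_suml.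
    congr (_ + _ * _ - _); apply: big_pred1 => v /=.
    by rewrite [u == v]eq_sym; case: eqP => [->|]; rewrite ?uS ?andbF.
  rewrite sum_common_nbr /drift -/W -/a; set B := (\sum_(t in S | _) _ * _).
  (* The differential equation makes the average of [q] equal to the target. *)
  have ode := fext_ode hf x0.
  have -> : (f x - fderiv x * ((B - a ^+ 2) / (W * w u))) * W =
     W * f x - fderiv x / w u * B + w u * (fderiv x * x ^+ 2).
    by rewrite aE; field; rewrite !gt_eqF.
  have -> : fderiv x * x ^+ 2 = 1 - f x + fderiv x * x - x * f x by lra.
  by rewrite aE; lra.
- by move=> v _; rewrite divr_ge0 ?ltW.
- by rewrite -mulr_suml divff ?gt_eqF.
- by move=> v vS; apply: attainable_add => //; exact: IH.
Qed.

(** * Euler step of the weights and the final induction *)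

Definition flow_step w S d u : R := w u * (1 + d * nbr_weight w S u / weight w S).

(** The ratio moves by exactly [d * D / (1 + d * al)], where [D] is the drift and [al = a / W] lies
    in [0, 1]. In the tangent inequality, replacing this by [d * D] costs at most [d ^+ 2], since
    [fderiv x * D <= 1]. *)
Lemma fext_flow_step w S d u : (forall v, 0 < w v) -> u \in S -> 0 <= d ->
  f (nbr_ratio w S u) + d * (fderiv (nbr_ratio w S u) * drift w S u) - d ^+ 2
  <= f (nbr_ratio (flow_step w S d) S u).
Proof.
move=> w0 uS d0; have W0 := weight_gt0 w0 uS.
have x0 : 0 <= nbr_ratio w S u by exact: nbr_ratio_ge0.
have a0 := nbr_weight_ge0 S u w0.
have aW := nbr_weight_le S u w0.
have nE : nbr_weight (flow_step w S d) S u = nbr_weight w S u +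
    d / weight w S * \sum_(t in S | e u t) w t * nbr_weight w S t.
  rewrite mulr_sumr -big_split/=; apply: eq_bigr => t _.
  by rewrite /flow_step; ring.
rewrite /drift; set B := (\sum_(t in S | _) _ * _) in nE *.
have B0 : 0 <= B.
  by apply: sumr_ge0 => t _; rewrite mulr_ge0 ?nbr_weight_ge0// ltW.
have BW : B <= nbr_weight w S u * weight w S.
  rewrite mulr_suml; apply: ler_sum => t _.
  by rewrite ler_wpM2l ?nbr_weight_le// ltW.
have x'E : nbr_ratio (flow_step w S d) S u = (nbr_weight w S u +
    d / weight w S * B) / (w u * (1 + d * nbr_weight w S u / weight w S)).
  by rewrite {1}/nbr_ratio nE.
have aE : nbr_weight w S u = nbr_ratio w S u * w u.
  by rewrite /nbr_ratio divfK ?gt_eqF.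
have wu0 := w0 u.
move: x0 a0 aW BW x'E aE.
move: (nbr_ratio (flow_step w S d) S u) (nbr_ratio w S u) (nbr_weight w S u).
move: (weight w S) W0 (w u) wu0 B B0 {nE} => W W0 y y0 B B0 x' x a.
move=> x0 a0 aW BW x'E aE.
pose al := a / W.
have al0 : 0 <= al by rewrite divr_ge0 // ltW.
have al1 : al <= 1 by rewrite ler_pdivrMr// mul1r.
have den0 : 0 < 1 + d * al by rewrite ltr_pwDl// mulr_ge0.
pose D := (B - a ^+ 2) / (W * y).
have DE : x' - x = d * D / (1 + d * al).
  rewrite x'E /D /al aE; field; rewrite !gt_eqF//=.
  by rewrite ltr_pwDl// -aE mulr_ge0.
have x'0 : 0 <= x'.
  rewrite x'E -mulrA -/al divr_ge0 ?mulr_ge0 ?addr_ge0 ?mulr_ge0 ?invr_ge0//; exact: ltW.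
(* A ratio 0 stays 0 under the step, as the tangent inequality demands. *)
have xx' : x = 0 -> x' = 0.
  move=> xE; have a_0 : a = 0 by rewrite aE xE mul0r.
  have B_0 : B = 0 by apply/le_anti; rewrite B0 andbT; move: BW; rewrite a_0 mul0r.
  by rewrite x'E a_0 B_0 mulr0 addr0 mul0r.
apply: le_trans (fext_tangent hf x0 x'0 xx'); rewrite -/D DE.
have k0 := fderiv_le0 x0.
have kx := fderiv_bound hf x0.
have f0 := fext_ge0 hf x0.
(* Drop the nonnegative term [B]. As [k <= 0], a lower bound on [D] bounds [k * D] from above. *)
have DB : - (al * x) <= D.
  rewrite /D /al [in X in - X]aE -subr_ge0.
  have -> : (B - a ^+ 2) / (W * y) - - (x * y / W * x) = B / (W * y).
    by rewrite aE; field; rewrite !gt_eqF.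
  by rewrite divr_ge0// mulr_ge0// ltW.
set k := fderiv x in k0 kx *.
have kD : k * D <= 1.
  have : k * D <= k * - (al * x) by rewrite ler_wnM2l.
  have : 0 <= - (x * k) by rewrite oppr_ge0 mulr_ge0_le0.
  move=> h1; have : al * - (x * k) <= 1 * - (x * k) by rewrite ler_wpM2r.
  by lra.
have -> : k * (d * D / (1 + d * al)) = d * (k * D) / (1 + d * al) by ring.
rewrite -addrA lerD2l ler_pdivlMr//.
have : al * (k * D) <= 1.
  by apply: (@le_trans _ _ (al * 1)); [rewrite ler_wpM2l|lra].
move: (k * D) => z hz.
have : 0 <= d ^+ 2 * (1 - al * z) by rewrite mulr_ge0 ?sqr_ge0//; lra.
have : 0 <= d ^+ 2 * (d * al) by rewrite mulr_ge0 ?sqr_ge0// mulr_ge0.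
by lra.
Qed.

(** The outer induction on the size of [S] feeds the greedy step. The inner one, on the deficit
    [8 / (m + 1)], is over all weights at once, because the Euler step changes them. *)
Theorem attainable_fext S w : (forall v, 0 < w v) ->
  attainable e S (fun u => f (nbr_ratio w S u)).
Proof.
have [n] := ubnP #|S|; elim: n S w => // n IHn S w Sn w0.
have [->|Sn0] := eqVneq S finset.set0.
  by apply: attainable_le0 => u; rewrite inE.
apply: (@attainable_closed _ _ e S _ (fun m => 8 * m.+1%:R^-1)).
  rewrite -[X in (_ --> X)%classic](mulr0 8); apply: cvgM; first exact: cvg_cst.
  exact: cvg_harmonic.
move=> m; elim: m w w0 => [|m IHm] w w0.
  (* Deficit 8 is trivial, since [f <= 1]. *)
  apply: attainable_le0 => u uS; have x0 := nbr_ratio_ge0 S u w0.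
  have := fderiv_bound hf x0; have := fderiv_le0 x0.
  move=> k0; have : nbr_ratio w S u * fderiv (nbr_ratio w S u) <= 0.
    by rewrite mulr_ge0_le0.
  by lra.
have [d dE] : exists d : R, d = 2 / m.+1%:R by exists (2 / m.+1%:R).
have m1 : 1 <= m.+1%:R :> R by rewrite ler1n.
have d0 : 0 <= d by rewrite dE divr_ge0.
have hP : attainable e S (fun u => f (nbr_ratio w S u)
                           - fderiv (nbr_ratio w S u) * drift w S u).
  apply: attainable_greedy => // v vS; apply: IHn => //.
  rewrite -ltnS; apply: leq_trans Sn; rewrite ltnS; apply: proper_card.
  apply/properP; split; last by exists v; rewrite // !inE eqxx andbF.
  by apply/fintype.subsetP => t; rewrite !inE => /andP[].
have w'0 v : 0 < flow_step w S d v.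
  rewrite mulr_gt0// ltr_pwDl// divr_ge0 ?mulr_ge0 ?nbr_weight_ge0//.
  by apply: sumr_ge0 => t _; exact: ltW.
(* The drift terms of the greedy step and of the Euler step cancel in the mixture. *)
apply: attainable_le (attainable_mix2 d0 hP (IHm _ w'0)) => u uS.
have := fext_flow_step w0 uS d0.
move: (f (nbr_ratio (flow_step _ _ _) S u)) (f (nbr_ratio w S u)) (_ * drift _ _ _) => y' y z h.
rewrite -[m.+2%:R]natr1; move: (m.+1%:R) m1 dE => c c1 dE.
rewrite ler_pdivlMr; last by lra.
have : d ^+ 2 + 8 * c^-1 <= 8 * (c + 1)^-1 * (1 + d); last by lra.
rewrite dE -subr_ge0.
(* Here [c = m + 1]; the slack is nonnegative as [c >= 1], and vanishes at [c = 1]. *)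
have -> : 8 * (c + 1)^-1 * (1 + 2 / c) - ((2 / c) ^+ 2 + 8 * c^-1) =
    4 * (c - 1) / (c ^+ 2 * (c + 1)) by field; lra.
by rewrite divr_ge0 ?mulr_ge0 ?sqr_ge0//; lra.
Qed.

End WeightFlow.

(** * Specialization to the whole vertex set *)

Theorem theorem2p1 (R : realType) (f : R -> R) (hf : is_fext f)
    (T : finType) (e : rel T) (e_sym : symmetric e) (e_irr : irreflexive e)
    (e_tf : triangle_free e) (w : T -> R) (w_gt0 : forall v : T, 0 < w v) :
  exists D : {ffun {set T} -> R},
    indep_distribution e D /\
    forall v : T,
      f (weight w (neighborhood e v) / w v) <= prob D (fun I => v \in I).
Proof.
have [D [hD _ DP]] := attainable_fext hf e_sym e_irr e_tf [set: T]%SET w_gt0.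
exists D; split=> // v; apply: le_trans (DP v _); last by rewrite inE.
rewrite /nbr_ratio /nbr_weight /weight le_eqVlt; apply/orP; left; apply/eqP.
by congr (f (_ / _)); apply: eq_bigl => t; rewrite !inE.
Qed.
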